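(* Let $X=\{X_t,t\ge 0\}$ be a Lévy insurance risk process, let $q>0$, and let $\mathbf{e}_q$ be an exponential random variable with rate $q$, independent of $X$. Let $\kappa_q$ be the time of exponential Parisian ruin with rate $q$, and let $\sigma_{\mathbf{e}_q}$ be the time of cumulative Parisian ruin at the random level $\mathbf{e}_q$. Then, for all $x\ge 0$ and $t>0$, $$\mathbb{P}_x(\kappa_q\le t)=\mathbb{P}_x(\sigma_{\mathbf{e}_q}\le t),$$ and, moreover, $$\mathbb{P}_x(\kappa_q<\infty)=\mathbb{P}_x(\sigma_{\mathbf{e}_q}<\infty).$$
   Context: A Lévy insurance risk process (equivalently, a spectrally negative Lévy process) is a càdlàg process $X=\{X_t,t\ge0\}$ with stationary and independent increments and no positive jumps. $\mathbb{P}_x$ denotes the law with initial value $X_0=x$. The convention $\inf\emptyset=\infty$ is used. Cumulative Parisian ruin: for $r>0$, $\sigma_r=\inf\{t>0:\int_0^t \mathbf{1}_{(-\infty,0)}(X_s)\,\mathrm{d}s>r\}$; $\sigma_{\mathbf{e}_q}$ is $\sigma_r$ evaluated at $r=\mathbf{e}_q$. Exponential Parisian ruin: let $g_t=\sup\{0\le s\le t: X_s\ge 0\}$. Each excursion of $X$ below $0$ (identified by its left endpoint $g$, the constant value of $g_t$ during that excursion) is marked with its own exponential random variable $\mathbf{e}_q^{g}$ with rate $q$; the marks of distinct excursions are independent copies of each other and are independent of $X$. Then $$\kappa_q=\inf\{t>0: t-g_t>\mathbf{e}_q^{g_t}\},$$ i.e. $\kappa_q$ is the first time at which the time elapsed in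 the current excursion below $0$ exceeds that excursion's own exponential clock. *)

(* Defs.v *)
From HB Require Import structures.
From mathcomp Require Import all_boot all_order all_algebra.
From mathcomp Require Import all_classical all_reals all_analysis.
From mathcomp Require Import measurable_realfun.

Set Implicit Arguments.
Unset Strict Implicit.
Unset Printing Implicit Defensive.

Import Order.TTheory GRing.Theory Num.Theory.
Import numFieldNormedType.Exports.

Local Open Scope classical_set_scope.
Local Open Scope ring_scope.

Definition sigma_gen d d' (T : measurableType d) (S : measurableType d')
    (I : Type) (D : set I) (Y : I -> T -> S) : set (set T) :=
  <<s \bigcup_(i in D) preimage_set_system setT (Y i) measurable >>.

Definition indep_systems d (T : measurableType d) (R : realType)
    (P : probability T R) (F G : set (set T)) : Prop :=
  forall A B, F A -> G B -> P (A `&` B) = (P A * P B)%E.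

Definition mutually_indep d d' (T : measurableType d) (S : measurableType d')
    (R : realType) (P : probability T R) (I : eqType) (Y : I -> T -> S) : Prop :=
  forall (s : seq I) (B : I -> set S), uniq s -> (forall i, measurable (B i)) ->
    P (\big[setI/setT]_(i <- s) (Y i @^-1` B i)) =
    (\prod_(i <- s) P (Y i @^-1` B i))%E.

Definition has_exponential_law d (T : measurableType d) (R : realType)
    (P : probability T R) (q : R) (Y : {RV P >-> R}) : Prop :=
  forall B, measurable B -> distribution P Y B = exponential_prob q B.

(* Processes are indexed by all of R, but only times t >= 0 are ever used. *)
Definition process_sigma d (T : measurableType d) (R : realType)
    (X : R -> T -> R) : set (set T) :=
  sigma_gen [set t : R | 0 <= t] X.

Definition cadlag (R : realType) (f : R -> R) : Prop :=
  (forall t : R, 0 <= t -> f s @[s --> t^'+] --> f t) /\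
  (forall t : R, 0 < t -> cvg (f s @[s --> t^'-])).

Definition no_positive_jumps (R : realType) (f : R -> R) : Prop :=
  forall t : R, 0 < t -> f t <= lim (f s @[s --> t^'-]).

Record levy_insurance_risk_process d (T : measurableType d) (R : realType)
    (P : probability T R) (x : R) (X : R -> {RV P >-> R}) : Prop := {
  levy_initial : P [set w | X 0 w = x] = 1%E ;
  levy_cadlag : forall w, cadlag (X ^~ w) ;
  levy_no_positive_jumps : forall w, no_positive_jumps (X ^~ w) ;
  levy_stationary : forall (s t : R) (B : set R), 0 <= s -> 0 <= t -> measurable B ->
    pushforward P (X (s + t) \- X s) B = pushforward P (X t \- X 0) B ;
  levy_independent : forall t : nat -> R, 0 <= t 0%N ->
    (forall n, t n <= t n.+1) ->
    mutually_indep P (fun n => X (t n.+1) \- X (t n)) }.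

Definition occupation_below0 (R : realType) (f : R -> R) (t : R) : \bar R :=
  (\int[lebesgue_measure]_(s in `[0%R, t]) (\1_(`]-oo, 0%R[) (f s))%:E)%E.

(* ereal_inf set0 = +oo. *)
Definition cumulative_parisian_ruin (R : realType) (f : R -> R) (r : R) : \bar R :=
  ereal_inf [set t%:E | t in
    [set t : R | 0 < t /\ (r%:E < occupation_below0 f t)%E]].

(* g_t; the convention sup set0 = 0 only matters when f is negative on [0, t]. *)
Definition last_nonneg (R : realType) (f : R -> R) (t : R) : R :=
  sup [set s | 0 <= s <= t /\ 0 <= f s].

Definition excursion_starts (R : realType) (f : R -> R) : set R :=
  [set last_nonneg f t | t in [set t | 0 <= t /\ f t < 0]].

(* The marks of a path are a function of the left endpoint g. *)
Definition exponential_parisian_ruin (R : realType) (f mark : R -> R) : \bar R :=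
  ereal_inf [set t%:E | t in
    [set t : R | 0 < t /\ mark (last_nonneg f t) < t - last_nonneg f t]].

(* An uncountable i.i.d. family indexed by g could not be evaluated measurably at
   the random time g_t.  The excursions are countably many: G lists each of their
   left endpoints exactly once (a non-finite value means that there is no k-th
   excursion), and E k is the clock of the excursion starting at G k.  The list
   need not be chronological, nor a function of X, so the clocks must be
   independent of the list as well as of X: otherwise one could sort the
   excursions by clock value.
   Points that start no excursion carry no clock; the sign condition there says
   that they trigger nothing when X_t >= 0, where t - g_t = 0. *)
Definition exponential_excursion_marks d (T : measurableType d) (R : realType)
    (P : probability T R) (X : R -> T -> R) (q : R) (mark : R -> T -> R) : Prop :=
  exists (G : nat -> {RV P >-> \bar R}) (E : nat -> {RV P >-> R}),
  [/\ (forall w, excursion_starts (X ^~ w) = [set g | exists k, G k w = g%:E]),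
      (forall w j k g, G j w = g%:E -> G k w = g%:E -> j = k) &
  [/\ forall k, has_exponential_law q (E k),
      mutually_indep P E,
      indep_systems P (sigma_gen setT E)
        <<s process_sigma X `|` sigma_gen setT G >>,
      (forall w k g, G k w = g%:E -> mark g w = E k w) &
      (forall w g, ~ excursion_starts (X ^~ w) g -> 0 <= mark g w)]].

(* Main.v *)
Require Import Defs.
From HB Require Import structures.
From mathcomp Require Import all_boot all_order all_algebra.
From mathcomp Require Import all_classical all_reals all_analysis.
From mathcomp Require Import measurable_realfun.
From mathcomp Require Import lra.

Set Implicit Arguments.
Unset Strict Implicit.
Unset Printing Implicit Defensive.

Import Order.TTheory GRing.Theory Num.Theory.
Import numFieldNormedType.Exports.

Local Open Scope classical_set_scope.
Local Open Scope ring_scope.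

(** Why the two ruin times have the same law.  For [t > 0] let [a_k] be the
    time that the k-th excursion below 0 has lasted by time [t].  The
    excursions partition the negative half of the path, so the sum of the
    [a_k] is the occupation time [occ t] of the negative half-line.

    On every path, [kappa < t] means that some excursion has outlived its clock
    by time [t], that is, [E_k < a_k] for some [k] (with [E_k] replaced by its
    positive part); this is [exponential_ruin_ltP].  Given the path and the list
    of its excursions, the clocks are still independent exponentials of rate
    [q], so no excursion outlives its clock with probability
    [\prod_k exp(-q a_k) = exp(-q occ t)] ([prob_some_clock_lt]): by lack of
    memory the separate clocks act like one clock running only while the path is
    negative.  Likewise [sigma < t] means that [e_q < occ t]
    ([cumulative_ruin_ltP]), and given the path this fails with probability
    [exp(-q occ t)] too.  Hence [kappa < t] and [sigma < t]
    both have probability [E(1 - exp(-q occ t))]; letting [t] decrease, resp.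
    tend to infinity, gives the two equalities.

    Conditioning on the path is done by [freezing], a Fubini argument for two
    independent random elements.  The first is the identity of the sample space
    with values in the same space with a coarser sigma-algebra: that of [X] for
    [sigma], and that of [X] and the list [G] of excursions for [kappa].  So
    [occ t] and the [a_k] must be measurable for these sigma-algebras.  For
    [occ t] this follows from the joint measurability in (w, s) of a
    right-continuous process.  For [a_k] the delicate point is to recognise
    measurably whether a time [s] with [X_s < 0] lies in the k-th excursion:
    the definition of [g_s], a supremum over uncountably many times, does not
    show this.
    But [g_s] is the last excursion start not after [s], so the condition is a
    countable one on the list [G] ([excursion_listP]).

    Right-continuity makes an excursion contain an interval to the right of
    each of its points, so that a clock which rings strictly before [t] leaves
    some length to be measured. *)

(** * Independence as a Fubini formula, and exponential clocks *)

Section freezing.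
Context d d1 d2 (T : measurableType d) (S1 : measurableType d1)
  (S2 : measurableType d2) (R : realType) (P : probability T R).
Variables (U : {RV P >-> S1}) (V : {RV P >-> S2}).

(** Independence says that the law of [(U, V)] is the product of the marginal
    laws, and a product measure integrates the measures of sections.  This
    plays the role of conditioning on [U]. *)
Lemma freezing : (forall A B, measurable A -> measurable B ->
    P (U @^-1` A `&` V @^-1` B) = (P (U @^-1` A) * P (V @^-1` B))%E) ->
  forall C : set (S1 * S2), measurable C ->
  P [set w | C (U w, V w)] = (\int[P]_w P (V @^-1` xsection C (U w)))%E.
Proof.
move=> indUV C mC.
have mUV : measurable_fun [set: T] (fun w => (U w, V w)).
  exact: measurable_fun_pair.
pose UV : {RV P >-> (S1 * S2)%type} :=
  HB.pack (fun w => (U w, V w)) (isMeasurableFun.Build _ _ _ _ _ mUV).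
rewrite -[LHS]/(distribution P UV C).
rewrite -(@product_measure_unique _ _ _ _ _ (distribution P U)
  (distribution P V) (distribution P UV)) //.
rewrite /product_measure1 ge0_integral_distribution//.
exact: measurable_fun_xsection.
Qed.

End freezing.

Section exponential_clocks.
Context d (T : measurableType d) (R : realType) (P : probability T R).
Variables (q : R).

Lemma exponential_law_lt (E : {RV P >-> R}) (a : R) :
  has_exponential_law q E -> 0 <= a ->
  P [set w | E w < a] = (1 - (expR (- q * a))%:E)%E.
Proof.
move=> hE a0.
rewrite (_ : [set w | E w < a] = E @^-1` `]-oo, a[); last first.
  by apply/seteqP; split => w /=; rewrite in_itv.
rewrite -[LHS]/(distribution P E _) hE// /exponential_prob.
have mpdf D : measurable_fun D (EFin \o exponential_pdf q).
  apply: measurable_funTS; apply/measurable_EFinP.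
  exact: measurable_exponential_pdf.
rewrite integral_itv_bndo_bndc// integral_mkcond.
rewrite (_ : _ \_ _ = (EFin \o exponential_pdf q) \_ `[0, a]); last first.
  apply/funext => x; rewrite !patchE !mem_setE !in_itv/=.
  by case: (leP 0 x) => //= x0; case: ifPn => //; rewrite lt0_exponential_pdf.
rewrite -integral_mkcond.
move: a0; rewrite le_eqVlt => /orP[/eqP<-|a0].
  by rewrite set_itv1 integral_set1 mulr0 expR0 subee.
exact: exponential_prob_itv0c.
Qed.
Lemma clock_survival (E : {RV P >-> R}) (a : R) :
  has_exponential_law q E -> 0 <= a ->
  P [set w | a <= Num.max (E w) 0] = (expR (- q * a))%:E.
Proof.
move=> hE; rewrite le_eqVlt => /orP[/eqP<-|a0].
  rewrite mulr0 expR0 -(@probability_setT _ _ _ P); congr (P _).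
  by apply/seteqP; split => w //= _; rewrite le_max lexx orbT.
rewrite (_ : [set w | _] = ~` [set w | E w < a]); last first.
  apply/seteqP; split => w /=; rewrite le_max (leNgt a 0) a0 orbF leNgt.
    by move/negP.
  by move=> /negP.
rewrite probability_setC; last first.
  rewrite (_ : [set w | _] = E @^-1` `]-oo, a[); last first.
    by apply/seteqP; split => w /=; rewrite in_itv.
  exact: measurable_funPTI.
rewrite exponential_law_lt ?ltW// oppeB ?addeA ?subee ?add0e//.
Qed.

(** The probability that every clock exceeds its allotted time is a product of
    exponentials, so it depends on the times [a k] only through their sum.  The
    positive part makes the case [a k = 0] exact: an excursion that has not
    started must not trigger anything, even on the null event where its clock
    is negative. *)
Lemma prob_some_clock_lt (E : nat -> {RV P >-> R}) (a : nat -> R) (L : R) :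
  (forall k, has_exponential_law q (E k)) -> mutually_indep P E ->
  (forall k, 0 <= a k) -> (\sum_(k <oo) (a k)%:E = L%:E)%E ->
  P [set w | exists k, Num.max (E k w) 0 < a k] = (1 - (expR (- q * L))%:E)%E.
Proof.
move=> hE indE a0 aL.
pose B k := [set e : R | a k <= Num.max e 0].
have mB k : measurable (B k).
  have mmax : measurable_fun [set: R] (fun e => Num.max e 0).
    exact: measurable_maxr.
  rewrite (_ : B k = setT `&` (fun e => Num.max e 0) @^-1` `[a k, +oo[).
    exact: mmax.
  by apply/seteqP; split => e /=; rewrite /B/= in_itv/= andbT => // -[].
pose F n := \big[setI/setT]_(0 <= k < n) (E k @^-1` B k).
have FE n w : F n w <-> forall k, (k < n)%N -> a k <= Num.max (E k w) 0.
  by rewrite /F big_mkord -(bigcap_mkord n (fun k => E k @^-1` B k)).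
have mF n : measurable (F n).
  rewrite /F big_mkord; apply: bigsetI_measurable => k _.
  exact: measurable_funPTI.
have PF n : P (F n) = (expR (- q * \sum_(0 <= k < n) a k))%:E.
  rewrite /F indE ?iota_uniq//.
  rewrite mulr_sumr expR_sum (big_morph EFin (@EFinM R) (erefl 1%E)).
  apply: eq_bigr => k _.
  exact: clock_survival.
have mcap : measurable (\bigcap_n F n) by exact: bigcapT_measurable.
have <- : ~` (\bigcap_n F n) = [set w | exists k, Num.max (E k w) 0 < a k].
  apply/seteqP; split => [w /= nF|w [k Ek] /= Fw]; last first.
    by have /FE/(_ k (ltnSn _)) := Fw k.+1 I; rewrite leNgt Ek.
  apply: contrapT => nE; apply: nF => n _; apply/FE => k _; rewrite leNgt.
  by apply/negP => Ek; apply: nE; exists k.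
rewrite probability_setC//; congr (1 - _)%E.
have Foo : (P \o F) n @[n --> \oo] --> P (\bigcap_n F n).
  apply: nonincreasing_cvg_mu => //; first by rewrite ltey_eq fin_num_measure.
  move=> m n mn; apply/subsetPset => w /FE Fn; apply/FE => k km.
  by apply: Fn; exact: leq_trans mn.
have soo : \sum_(0 <= k < n) a k @[n --> \oo] --> L.
  rewrite (_ : (fun n => _) =
      fine \o (fun n => \sum_(0 <= k < n) (a k)%:E)%E); last first.
    by apply/funext => n /=; rewrite sumEFin.
  apply: fine_cvg; rewrite -aL; apply: is_cvg_nneseries => k _ _.
  by rewrite lee_fin.
have PFoo : (P \o F) n @[n --> \oo] --> (expR (- q * L))%:E.
  rewrite (_ : P \o F =
    EFin \o (fun n => expR (- q * \sum_(0 <= k < n) a k))); last first.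
    by apply/funext => n; exact: PF.
  apply: cvg_EFin; first exact: nearW.
  apply: (@cvg_comp _ _ _ (fun n => - q * \sum_(0 <= k < n) a k) expR
    _ (nbhs (- q * L))); last exact: continuous_expR.
  exact: cvgMr.
by rewrite -(cvg_lim _ Foo)// -(cvg_lim _ PFoo).
Qed.
End exponential_clocks.

(** * Excursions below 0 of a fixed path *)

Section path.
Context (R : realType) (f : R -> R).
Implicit Types (s t u v g : R).

Lemma nonneg_times_has_ubound s : has_ubound [set v | 0 <= v <= s /\ 0 <= f v].
Proof. by exists s => v [/andP[]]. Qed.

Lemma le_last_nonneg v s : 0 <= v -> v <= s -> 0 <= f v ->
  v <= last_nonneg f s.
Proof.
move=> v0 vs fv; apply: ub_le_sup; first exact: nonneg_times_has_ubound.
by split => //; rewrite v0.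
Qed.

Lemma last_nonneg_itv s : 0 <= s -> 0 <= last_nonneg f s <= s.
Proof.
move=> s0; rewrite /last_nonneg.
have [->|/set0P A0] := eqVneq [set v | 0 <= v <= s /\ 0 <= f v] set0.
  by rewrite sup0 lexx.
apply/andP; split; last by apply: ge_sup => // v [/andP[]].
case: (A0) => v [/andP[v0 vs] fv]; apply: le_trans (le_last_nonneg v0 vs fv).
exact: v0.
Qed.

Lemma last_nonneg_id s : 0 <= s -> 0 <= f s -> last_nonneg f s = s.
Proof.
move=> s0 fs; apply/eqP; rewrite eq_le le_last_nonneg//.
by have /andP[_ ->] := last_nonneg_itv s0.
Qed.

Lemma neg_after_last_nonneg s u : 0 <= s -> last_nonneg f s < u -> u <= s ->
  f u < 0.
Proof.
move=> s0 su us; rewrite ltNge; apply/negP => fu.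
have /andP[l0 _] := last_nonneg_itv s0.
by have := le_last_nonneg (le_trans l0 (ltW su)) us fu; rewrite leNgt su.
Qed.

(** No nonnegative time lies strictly between [last_nonneg f s] and [s], so the
    supremum is taken over the same set at all times in between. *)
Lemma last_nonneg_stable s u : 0 <= s -> last_nonneg f s <= u -> u <= s ->
  last_nonneg f u = last_nonneg f s.
Proof.
move=> s0 su us; congr (sup _); apply/seteqP; split => v /= [/andP[v0 vu] fv].
  by rewrite v0 (le_trans vu us).
by rewrite v0 (le_trans _ su)// le_last_nonneg.
Qed.

(** Every excursion start is its own last nonnegative time, whereas a time
    strictly between [last_nonneg f s] and [s] has [last_nonneg f s] for last
    nonnegative time.  So [last_nonneg f s] is the last start up to [s]. *)
Lemma excursion_start_gap s g : 0 <= s -> excursion_starts f g ->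
  last_nonneg f s < g -> s < g.
Proof.
move=> s0 [t [t0 ft] <-{g}] lt; rewrite ltNge; apply/negP => le.
have /andP[_ lt'] := last_nonneg_itv t0.
have := last_nonneg_stable s0 (ltW lt) le.
by rewrite (last_nonneg_stable t0 (lexx _) lt') => e; rewrite e ltxx in lt.
Qed.

(** The part before time [t] of the excursion with left endpoint [g].  An
    infinite [g], which stands for a missing excursion, gives the empty set. *)
Definition excursion (g : \bar R) t : set R :=
  [set s | 0 <= s <= t /\ f s < 0 /\ (last_nonneg f s)%:E = g].

Lemma excursion_interval (g : \bar R) t : is_interval (excursion g t).
Proof.
move=> a b [/andP[a0 at_] [fa ag]] [/andP[b0 bt] [fb bg]] u /andP[au ub].
have lab : last_nonneg f a = last_nonneg f b by apply: EFin_inj; rewrite ag.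
have lu : last_nonneg f b <= u.
  by rewrite -lab; have /andP[_ h] := last_nonneg_itv a0; exact: le_trans h au.
split; first by rewrite (le_trans a0 au) (le_trans ub bt).
split; last by rewrite (last_nonneg_stable b0 lu ub).
move: lu; rewrite le_eqVlt => /orP[/eqP lu|lu].
  suff -> : u = a by [].
  apply/eqP; rewrite eq_le au -lu -lab.
  by have /andP[_ ->] := last_nonneg_itv a0.
exact: neg_after_last_nonneg lu ub.
Qed.

Lemma measurable_excursion (g : \bar R) t : measurable (excursion g t).
Proof. by apply: is_interval_measurable; exact: excursion_interval. Qed.

Section right_continuous.
Hypothesis f_right : forall t, 0 <= t -> f s @[s --> t^'+] --> f t.

(** Right-continuity keeps the path negative for a while after [s], and then no
    new excursion can have begun. *)
Lemma excursion_right_open s : 0 <= s -> f s < 0 ->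
  exists2 v, s < v & forall u, s <= u -> u < v ->
    f u < 0 /\ last_nonneg f u = last_nonneg f s.
Proof.
move=> s0 fs; have := f_right s0.
move=> /cvgrPdist_lt /(_ (- f s)); rewrite oppr_gt0 => /(_ fs).
move=> [e /= e0 He]; exists (s + e); first by rewrite ltrDl.
have neg u : s <= u -> u < s + e -> f u < 0.
  rewrite le_eqVlt => /orP[/eqP<-//|su use].
  have /= := He u; rewrite ltr_distlC => H.
  have : `|f s - f u| < - f s.
    apply: He => //=; rewrite distrC ger0_norm ?subr_ge0 ?ltW//; lra.
  by rewrite ltr_norml => /andP[h _]; lra.
move=> u su use; split; first exact: neg.
apply/esym/last_nonneg_stable => //; first exact: le_trans su.
rewrite /last_nonneg.
have [->|/set0P A0] := eqVneq [set v | 0 <= v <= u /\ 0 <= f v] set0.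
  by rewrite sup0.
apply: ge_sup => // v [/andP[v0 vu] fv]; rewrite leNgt; apply/negP => sv.
by have := neg v (ltW sv) (le_lt_trans vu use); rewrite ltNge fv.
Qed.

End right_continuous.

Section listing.
Variable G : nat -> \bar R.
Hypothesis G_starts : excursion_starts f = [set g | exists k, G k = g%:E].
Hypothesis G_inj : forall j k g, G j = g%:E -> G k = g%:E -> j = k.
Local Notation mu := (@lebesgue_measure R).

(** The right-hand side involves the path only through the list of excursion
    starts.  This is what makes membership in the k-th excursion an event of
    the sigma-algebra generated by the process and the list. *)
Lemma excursion_listP k s : 0 <= s -> f s < 0 ->
  (last_nonneg f s)%:E = G k <->
  (G k <= s%:E)%E /\ forall j, (G j <= G k)%E \/ (s%:E < G j)%E.
Proof.
move=> s0 fs; have /andP[_ ls] := last_nonneg_itv s0.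
have start g j : G j = g%:E -> excursion_starts f g.
  by move=> Gj; rewrite G_starts; exists j.
split=> [<-|[Gks Gk]].
  split; first by rewrite lee_fin.
  move=> j; have [|lGj] := leP (G j) (last_nonneg f s)%:E; [by left|right].
  move: lGj; case: (G j) (start^~ j) => // [g|] sg lg; last exact: ltry.
  rewrite lte_fin in lg *; apply: excursion_start_gap lg => //; exact: sg.
have [m Gm] : exists k, G k = (last_nonneg f s)%:E.
  have : excursion_starts f (last_nonneg f s) by exists s.
  by rewrite G_starts.
have lGk : ((last_nonneg f s)%:E <= G k)%E.
  by case: (Gk m); rewrite Gm// lte_fin ltNge ls.
apply/eqP; rewrite eq_le lGk /= leNgt; apply/negP.
move: Gks lGk; case: (G k) (start^~ k) => // g sg gs _ lg.
rewrite lte_fin in lg; rewrite lee_fin in gs.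
have := excursion_start_gap s0 (sg g erefl) lg.
by rewrite ltNge gs.
Qed.

Definition negative_until t : set R := [set s | 0 <= s <= t /\ f s < 0].

Lemma negative_until_excursions t :
  negative_until t = \bigcup_k excursion (G k) t.
Proof.
apply/seteqP; split => [s [st fs]|s [k _ [st [fs _]]]] //.
have : excursion_starts f (last_nonneg f s).
  by exists s => //; split => //; case/andP: st.
by rewrite G_starts => -[k Gk]; exists k.
Qed.

Lemma measurable_negative_until t : measurable (negative_until t).
Proof.
rewrite negative_until_excursions; apply: bigcupT_measurable => k.
exact: measurable_excursion.
Qed.

(** The full preimage of the negative half-line depends on the arbitrary values
    of [f] at negative times and need not be measurable, so its indicator is
    first replaced by that of [negative_until t]. *)
Lemma occupation_below0E t : occupation_below0 f t = mu (negative_until t).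
Proof.
rewrite /occupation_below0.
transitivity (\int[mu]_(s in `[0%R, t]) (\1_(negative_until t) s)%:E)%E.
  apply: eq_integral => s; rewrite inE/= in_itv/= => st.
  rewrite !indicE; congr (_%:R%:E); congr nat_of_bool.
  apply/idP/idP; rewrite !inE/= in_itv//=; last by case.
rewrite integral_indic//; last exact: measurable_negative_until.
congr (mu _); apply/seteqP; split => s /= => [[]//|[st fs]].
by split => //; rewrite in_itv.
Qed.

Lemma occupation_below0_excursions t :
  (\sum_(k <oo) mu (excursion (G k) t) = occupation_below0 f t)%E.
Proof.
rewrite occupation_below0E negative_until_excursions measure_bigcup//=.
- by apply: eq_eseriesl => k; rewrite in_setT.
- by move=> k _; exact: measurable_excursion.
- move=> i j _ _ [s [[_ [_ si]] [_ [_ sj]]]].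
  exact: G_inj (esym si) (esym sj).
Qed.

Lemma negative_until_ub t : 0 <= t -> (mu (negative_until t) <= t%:E)%E.
Proof.
move=> t0; rewrite -[leRHS](_ : mu `[0, t] = _); last first.
  by rewrite lebesgue_measure_itv/= lte_fin; case: ltgtP t0 => // [_|<-] _;
    rewrite ?sube0.
apply: le_measure; rewrite ?inE//; first exact: measurable_negative_until.
by move=> s [st _] /=; rewrite in_itv.
Qed.

(** The occupation time is 1-Lipschitz in [t]: if it exceeds [r] at [t], it
    already does so slightly earlier. *)
Lemma cumulative_ruin_ltP r t : 0 < t ->
  (cumulative_parisian_ruin f r < t%:E)%E <-> (r%:E < occupation_below0 f t)%E.
Proof.
move=> t0; split=> [/ereal_inf_lt[_ [s [s0 rs] <-]]|rt].
  rewrite lte_fin => st; apply: lt_le_trans rs _.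
  rewrite !occupation_below0E; apply: le_measure; rewrite ?inE;
    [exact: measurable_negative_until..|].
  move=> u [/andP[u0 us] fu]; split => //.
  by rewrite u0 (le_trans us) // ltW.
rewrite occupation_below0E in rt.
have tfin : mu (negative_until t) \is a fin_num.
  rewrite ge0_fin_numE//; apply: le_lt_trans (ltry t).
  exact: negative_until_ub (ltW t0).
set m := fine (mu (negative_until t)).
have mE : mu (negative_until t) = m%:E by rewrite fineK.
rewrite mE lte_fin in rt.
have mt : m <= t by rewrite -lee_fin -mE; exact: negative_until_ub (ltW t0).
(* a time before t that gives up less occupation time than m - r *)
pose s := Num.max (t / 2) (t - (m - r) / 2).
have s0 : 0 < s by rewrite lt_max divr_gt0.
have st : s < t by rewrite gt_max; apply/andP; split; lra.
have ts : t - s < m - r.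
  have : t - (m - r) / 2 <= s by rewrite le_max lexx orbT.
  lra.
apply/ereal_inf_ltP; exists s%:E; rewrite ?lte_fin//; exists s => //.
split => //; rewrite occupation_below0E.
have : (m%:E <= mu (negative_until s) + (t - s)%:E)%E.
  rewrite -mE -[X in (_ + X)%E](_ : mu `]s, t] = _); last first.
    by rewrite lebesgue_measure_itv/= lte_fin st EFinB.
  apply: le_trans (measureU2 _ _ _); rewrite //; last first.
    exact: measurable_negative_until.
  apply: le_measure; rewrite ?inE; [exact: measurable_negative_until| |].
    by apply: measurableU => //; exact: measurable_negative_until.
  move=> u [/andP[u0 ut] fu]; have [us|su] := leP u s; [left|right].
    by split => //; rewrite u0.
  by rewrite /= in_itv/= su.
rewrite -leeBlDr// -EFinB; apply: lt_le_trans; rewrite lte_fin; lra.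
Qed.

Section exponential_ruin.
Hypothesis f_right : forall t, 0 <= t -> f s @[s --> t^'+] --> f t.
Variables (mark : R -> R) (E : nat -> R).
Hypothesis mark_clock : forall k g, G k = g%:E -> mark g = E k.
Hypothesis mark_ge0 : forall g, ~ excursion_starts f g -> 0 <= mark g.

(** A trigger at [s] belongs to an excursion, as the other marks are
    nonnegative while [s - last_nonneg f s = 0] at a nonnegative [s].  If [s]
    is itself nonnegative, it is the left endpoint of an excursion whose mark
    is negative, and the excursion lies to the right of [s].  In all cases the
    excursion reaches strictly beyond [s] before time [t]. *)
Lemma trigger_excursion s t : 0 < s -> s < t ->
    mark (last_nonneg f s) < s - last_nonneg f s ->
  exists v, [/\ s < v, v <= t, excursion_starts f (last_nonneg f s) &
    `]last_nonneg f s, v[ `<=` excursion (last_nonneg f s)%:E t].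
Proof.
move=> s0 st ms; have sge0 := ltW s0.
have /andP[l0 ls] := last_nonneg_itv sge0.
have [fs|fs] := ltP (f s) 0.
  have [v' sv' hv'] := excursion_right_open f_right sge0 fs.
  exists (Num.min v' t); split; rewrite ?lt_min ?sv' ?ge_min ?lexx ?orbT//.
    by exists s.
  move=> u /=; rewrite in_itv/= lt_min => /and3P[lu uv' ut].
  have u0 := le_trans l0 (ltW lu).
  split; first by rewrite u0 ltW.
  have [us|su] := leP u s.
    by rewrite (last_nonneg_stable _ (ltW lu))// (neg_after_last_nonneg _ lu).
  by have [fu ->] := hv' u (ltW su) uv'.
rewrite last_nonneg_id// subrr in ms *.
have [r [r0 fr rs]] : excursion_starts f s.
  by apply: contrapT => /mark_ge0; rewrite leNgt ms.
have sr : s < r.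
  have /andP[_] := last_nonneg_itv r0; rewrite rs le_eqVlt => /orP[/eqP sr|//].
  by move: fr; rewrite -sr ltNge fs.
exists (Num.min r t); split; rewrite ?lt_min ?sr ?ge_min ?lexx ?orbT//.
  by exists r.
move=> u /=; rewrite in_itv/= lt_min => /and3P[su ur ut].
split; first by rewrite (le_trans sge0 (ltW su)) ltW.
have lu : last_nonneg f r < u by rewrite rs.
rewrite (neg_after_last_nonneg r0 lu (ltW ur)).
by rewrite (last_nonneg_stable r0 (ltW lu) (ltW ur)) rs.
Qed.

(** If all points of an excursion were within [e] of its left endpoint, it would
    fit in a closed interval of length [e]. *)
Lemma excursion_long (g : \bar R) e t : 0 <= e ->
  (e%:E < mu (excursion g t))%E ->
  exists s, [/\ excursion g t s, s < t & last_nonneg f s + e < s].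
Proof.
move=> e0 eg.
have [s0 es0] : exists s, excursion g t s.
  apply/set0P/eqP => e0'; rewrite e0' measure0 lte_fin in eg.
  by rewrite ltNge e0 in eg.
have [st0 [fs0 ls0]] := es0.
have [s [es les]] : exists s, excursion g t s /\ last_nonneg f s0 + e < s.
  apply: contrapT => nex; move: eg; rewrite ltNge => /negP; apply.
  rewrite -[leRHS](_ : mu `[last_nonneg f s0, last_nonneg f s0 + e] = _).
    apply: le_measure; rewrite ?inE//; first exact: measurable_excursion.
    move=> u eu; have [/andP[u0 ut] [fu lu]] := eu.
    rewrite /= in_itv/=; apply/andP; split; last first.
      by rewrite leNgt; apply/negP => lt; apply: nex; exists u.
    have -> : last_nonneg f s0 = last_nonneg f u by apply: EFin_inj; rewrite lu.
    by have /andP[_] := last_nonneg_itv u0.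
  rewrite lebesgue_measure_itv/= lte_fin -EFinB ltrDl addrC addKr.
  by case: ltgtP e0 => // <-.
have [/andP[sge0 st] [fs ls]] := es.
have lss0 : last_nonneg f s0 = last_nonneg f s.
  by apply: EFin_inj; rewrite ls.
rewrite lss0 in les.
(* [s] may be [t] itself, which is too late: step back a little *)
pose u := (last_nonneg f s + e + s) / 2.
have us : u < s by rewrite /u; lra.
have lu : last_nonneg f s + e < u by rewrite /u; lra.
have luu : last_nonneg f s < u by lra.
have /andP[l0 _] := last_nonneg_itv sge0.
have lE := last_nonneg_stable sge0 (ltW luu) (ltW us).
exists u; split; [|exact: lt_le_trans st|by rewrite lE].
split; first by rewrite (le_trans l0 (ltW luu)) (le_trans (ltW us)).
by rewrite lE (neg_after_last_nonneg sge0 luu (ltW us)).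
Qed.

(** The clock of an excursion rings strictly before [t] iff the excursion has
    accumulated by time [t] a length larger than the clock.  The strict
    inequality [< t] is what makes this exact, without exceptional paths. *)
Lemma exponential_ruin_ltP t :
  (exponential_parisian_ruin f mark < t%:E)%E <->
  exists k, ((Num.max (E k) 0)%:E < mu (excursion (G k) t))%E.
Proof.
split=> [/ereal_inf_lt[_ [s [s0 ms] <-]]|[k Ek]].
  rewrite lte_fin => st.
  have [v [sv vt lG lv]] := trigger_excursion s0 st ms.
  move: lG; rewrite G_starts => -[k Gk]; exists k.
  rewrite (mark_clock Gk) in ms; rewrite Gk.
  have /andP[_ ls] := last_nonneg_itv (ltW s0).
  apply: (@lt_le_trans _ _ (mu `]last_nonneg f s, v[)); last first.
    by apply: le_measure; rewrite ?inE//; exact: measurable_excursion.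
  rewrite lebesgue_measure_itv/= lte_fin (le_lt_trans ls sv) -EFinB lte_fin.
  by rewrite gt_max; apply/andP; split; lra.
have E0 : 0 <= Num.max (E k) 0 by rewrite le_max lexx orbT.
have [s [[/andP[s0 _] [_ ls]] st les]] := excursion_long E0 Ek.
have /andP[l0 _] := last_nonneg_itv s0.
apply/ereal_inf_ltP; exists s%:E; rewrite ?lte_fin//; exists s => //.
split; first by lra.
rewrite (mark_clock (esym ls)); apply: le_lt_trans (_ : Num.max (E k) 0 < _).
  by rewrite le_max lexx.
lra.
Qed.

End exponential_ruin.

End listing.
End path.

(** * Measurability of excursion lengths *)

Section joint_measurability.
Context d (T : measurableType d) (R : realType) (X : R -> T -> R).
Hypothesis mX : forall t, 0 <= t -> measurable_fun [set: T] (X t).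
Hypothesis X_right : forall w t, 0 <= t -> X s w @[s --> t^'+] --> X t w.
Local Notation mu := (@lebesgue_measure R).

(** The first multiple of [1/(n+1)] strictly after [s]. *)
Let grid (n : nat) (s : R) : R := (Num.truncn (n.+1%:R * s)).+1%:R / n.+1%:R.

Let grid_itv n s : 0 <= s -> s < grid n s <= s + n.+1%:R^-1.
Proof.
rewrite /grid; have : (0 : R) < n.+1%:R by rewrite ltr0n.
move: n.+1%:R => N N0 s0; have : 0 <= N * s by rewrite mulr_ge0// ltW.
move=> /truncn_itv/andP[h1 h2]; apply/andP; split.
  by rewrite ltr_pdivlMr// mulrC.
by rewrite ler_pdivrMr// mulrDl mulVf ?gt_eqF// -natr1 lerD2r [s * N]mulrC.
Qed.

Let measurable_grid n :
  measurable_fun [set p : T * R | 0 <= p.2] (fun p => X (grid n p.2) p.1).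
Proof.
have N0 : (0 : R) < n.+1%:R by rewrite ltr0n.
move=> _ B mB.
rewrite (_ : _ `&` _ = \bigcup_k ((X (k.+1%:R / n.+1%:R) @^-1` B) `*`
    [set` `[k%:R / n.+1%:R, k.+1%:R / n.+1%:R[])).
  apply: bigcupT_measurable => k; apply: measurableX => //.
  by rewrite -[X in measurable X]setTI; apply: mX => //; rewrite divr_ge0.
apply/seteqP; split => [[w s]/= [s0 Bs]|[w s]/= [k _ [Bw]]].
  exists (Num.truncn (n.+1%:R * s)) => //; split => //=.
  have : 0 <= n.+1%:R * s by rewrite mulr_ge0// ler0n.
  move=> /truncn_itv/andP[h1 h2].
  by rewrite in_itv/= ler_pdivrMr// ltr_pdivlMr// [s * _]mulrC h1.
rewrite /= in_itv/= ler_pdivrMr// ltr_pdivlMr// => /andP[ks sk].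
split; first by rewrite -(pmulr_lge0 _ N0); exact: le_trans ks.
rewrite /= /grid (_ : Num.truncn _ = k)//.
by apply: truncn_def; rewrite mulrC ks.
Qed.

(** Sampling the process at the next point of a finer and finer grid gives step
    processes, which converge pointwise by right-continuity. *)
Lemma measurable_right_continuous_process :
  measurable_fun [set p : T * R | 0 <= p.2] (fun p => X p.2 p.1).
Proof.
apply: (@measurable_fun_cvg _ _ _ _ (fun n p => X (grid n p.2) p.1)) => //.
move=> [w s]/= s0; apply/cvgrPdist_lt => e e0.
have /cvgrPdist_lt /(_ e e0)[r /= r0 Hr] := @X_right w s s0.
near=> n.
have /andP[sg gs] := grid_itv n s0.
apply: Hr => //=; rewrite distrC ger0_norm ?subr_ge0 ?ltW//.
rewrite ltrBlDl; apply: le_lt_trans gs _; rewrite ltrD2l.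
by near: n; exact: near_infty_natSinv_lt (PosNum r0).
Unshelve. all: by end_near. Qed.

Let measurable_before t : measurable [set p : T * R | 0 <= p.2 <= t].
Proof.
rewrite (_ : [set _ | _] = setT `*` `[0, t]).
  exact: measurableX.
by apply/seteqP; split => [[w s]|[w s] []] /=; rewrite in_itv.
Qed.

Let measurable_negative t :
  measurable [set p : T * R | 0 <= p.2 <= t /\ X p.2 p.1 < 0].
Proof.
have m0 : measurable [set p : T * R | 0 <= p.2].
  rewrite (_ : [set _ | _] = setT `*` `[0, +oo[).
    exact: measurableX.
  by apply/seteqP; split => [[w s]|[w s] []] /=; rewrite in_itv/= andbT.
have mneg := measurable_right_continuous_process m0 (measurable_itv `]-oo, 0[).
rewrite (_ : [set _ | _] = [set p : T * R | 0 <= p.2 <= t] `&`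
    ([set p | 0 <= p.2] `&` (fun p => X p.2 p.1) @^-1` `]-oo, 0[)).
  exact: measurableI.
apply/seteqP; split => [[w s]/= [/andP[s0 st] Xs]|[w s]/= [st [_]]].
  by rewrite in_itv/= s0 st.
by rewrite in_itv/=.
Qed.

Lemma measurable_negative_length t :
  measurable_fun [set: T] (fun w => mu (negative_until (X ^~ w) t)).
Proof.
have := measurable_fun_xsection mu (measurable_negative t).
congr measurable_fun; apply/funext => w /=; congr (mu _).
by apply/seteqP; split => s /=; rewrite /xsection/= inE.
Qed.

Variable G : nat -> T -> \bar R.
Hypothesis mG : forall k, measurable_fun [set: T] (G k).
Hypothesis G_starts :
  forall w, excursion_starts (X ^~ w) = [set g | exists k, G k w = g%:E].

(** The length is the measure of a section of a measurable subset of the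
    product space, described through [excursion_listP]. *)
Lemma measurable_excursion_length k t :
  measurable_fun [set: T] (fun w => mu (excursion (X ^~ w) (G k w) t)).
Proof.
pose A := [set p : T * R | 0 <= p.2 <= t /\ X p.2 p.1 < 0] `&`
  ([set p | (G k p.1 <= p.2%:E)%E] `&`
  \bigcap_j ([set p | (G j p.1 <= G k p.1)%E] `|`
             [set p | (p.2%:E < G j p.1)%E])).
have mG1 j : measurable_fun [set: T * R] (fun p => G j p.1).
  exact: measurableT_comp.
have mE2 : measurable_fun [set: T * R] (fun p => p.2%:E).
  exact: measurableT_comp.
have mA : measurable A.
  apply: measurableI => //; apply: measurableI.
    by rewrite -[X in measurable X]setTI; exact: measurable_lee.
  apply: bigcapT_measurable => j; apply: measurableU.
    by rewrite -[X in measurable X]setTI; exact: measurable_lee.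
  by rewrite -[X in measurable X]setTI; exact: measurable_lte.
have := measurable_fun_xsection mu mA.
congr measurable_fun; apply/funext => w /=; congr (mu _).
apply/seteqP; split => s /=; rewrite /xsection/= inE /A/=.
  move=> [[/andP[s0 st] Xs] [Gks Gj]]; split; first by rewrite s0.
  split => //; apply/(excursion_listP (G_starts w)) => //; split => // j.
  exact: Gj.
move=> [/andP[s0 st] [Xs]] /(excursion_listP (G_starts w) _ s0 Xs)[Gks Gj].
by split; [rewrite s0|split => // j _; exact: Gj].
Qed.

End joint_measurability.

(** * Limits of distribution functions *)

Section limits.
Context d (T : measurableType d) (R : realType) (P : probability T R).

Lemma cvg_prob_right (K : T -> \bar R) t :
  (forall s, t < s -> measurable [set w | (K w < s%:E)%E]) ->
  P [set w | (K w < (t + n.+1%:R^-1)%:E)%E] @[n --> \oo] -->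
  P [set w | (K w <= t%:E)%E].
Proof.
move=> mK.
have lt n : t < t + n.+1%:R^-1 by rewrite ltrDl.
have cap : \bigcap_n [set w | (K w < (t + n.+1%:R^-1)%:E)%E] =
    [set w | (K w <= t%:E)%E].
  apply/seteqP; split => w /= Kw; last first.
    by move=> n _ /=; apply: le_lt_trans Kw _; rewrite lte_fin.
  rewrite leNgt; apply/negP => tK.
  have [r tr rK] : exists2 r, t < r & (r%:E <= K w)%E.
    case: (K w) tK => // [r|_]; first by exists r; rewrite // -lte_fin.
    by exists (t + 1); rewrite ?ltrDl// leey.
  rewrite -subr_gt0 in tr.
  have [n _ nr] := near_infty_natSinv_lt (PosNum tr).
  have := Kw n I; rewrite /= ltNge => /negP; apply; apply: le_trans rK.
  by rewrite lee_fin -lerBrDl ltW//; exact: (nr n (leqnn n)).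
rewrite -cap; apply: nonincreasing_cvg_mu.
- by rewrite ltey_eq fin_num_measure//; exact: mK.
- by move=> n; exact: mK.
- by apply: bigcapT_measurable => n; exact: mK.
- move=> m n mn; apply/subsetPset => w /= Kw; apply: lt_le_trans Kw _.
  by rewrite lee_fin lerD2l lef_pV2 ?posrE// ler_nat.
Qed.

Lemma cvg_prob_lty (K : T -> \bar R) :
  (forall s, 0 < s -> measurable [set w | (K w < s%:E)%E]) ->
  P [set w | (K w < n.+1%:R%:E)%E] @[n --> \oo] --> P [set w | (K w < +oo)%E].
Proof.
move=> mK.
have cup : \bigcup_n [set w | (K w < n.+1%:R%:E)%E] = [set w | (K w < +oo)%E].
  apply/seteqP; split => w /= => [[n _ Kn]|].
    by apply: lt_trans Kn _; exact: ltry.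
  case Kw : (K w) => [r| |]// _; last by exists 0%N; rewrite //= Kw ltNyr.
  exists (Num.truncn r); rewrite //= Kw lte_fin.
  exact: truncnS_gt.
rewrite -cup; apply: nondecreasing_cvg_mu.
- by move=> n; exact: mK.
- by apply: bigcupT_measurable => n; exact: mK.
- move=> m n mn; apply/subsetPset => w /= Kw; apply: lt_le_trans Kw _.
  by rewrite lee_fin ler_nat.
Qed.

End limits.

(** * Laws of the two ruin times *)

Section subsigma.
Context d (T : measurableType d).

Lemma sigma_gen_measurable d' (S : measurableType d') (I : Type) (D : set I)
    (Y : I -> T -> S) : (forall i, D i -> measurable_fun [set: T] (Y i)) ->
  sigma_gen D Y `<=` measurable.
Proof.
move=> mY; apply: smallest_sub; first exact: sigma_algebra_measurable.
by move=> _ [i Di [B mB <-]]; exact: mY.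
Qed.

Lemma sigma_gen_measurable_fun d' (S : measurableType d') (I : Type) (D : set I)
    (Y : I -> T -> S) (F : set (set T)) i :
  D i -> sigma_gen D Y `<=` <<s F >> ->
  measurable_fun [set: g_sigma_algebraType F] (Y i).
Proof.
move=> Di sub _ B mB; apply: sub; apply: sub_sigma_algebra.
by exists i => //; exists B.
Qed.

(** This turns conditioning on a sub-sigma-algebra into conditioning on a random
    element, in the form expected by [freezing]. *)
Lemma measurable_coarsen (F : set (set T)) : F `<=` measurable ->
  measurable_fun [set: T] (id : T -> g_sigma_algebraType F).
Proof.
move=> mF _ B mB; rewrite setTI preimage_id; move: B mB.
apply: smallest_sub => //; exact: sigma_algebra_measurable.
Qed.

End subsigma.

Section ruin_probabilities.
Context d (T : measurableType d) (R : realType) (P : probability T R).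
Variables (q : R) (X : R -> {RV P >-> R}).
Hypothesis X_right : forall w t, 0 <= t -> X s w @[s --> t^'+] --> X t w.
Variables (G : nat -> {RV P >-> \bar R}) (E : nat -> {RV P >-> R})
  (mark : R -> T -> R) (e_q : {RV P >-> R}).
Hypothesis G_starts :
  forall w, excursion_starts (X ^~ w) = [set g | exists k, G k w = g%:E].
Hypothesis G_inj : forall w j k g, G j w = g%:E -> G k w = g%:E -> j = k.

Let occ t w := occupation_below0 (X ^~ w) t.

Let occ_fin t w : 0 <= t -> occ t w \is a fin_num.
Proof.
move=> t0; rewrite /occ (occupation_below0E (G_starts w)).
rewrite ge0_fin_numE//; apply: le_lt_trans (ltry t).
exact: (negative_until_ub (G_starts w)).
Qed.

Let measurable_occ (F : set (set T)) t : process_sigma X `<=` <<s F >> ->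
  measurable_fun [set: g_sigma_algebraType F] (occ t).
Proof.
move=> sub; rewrite (_ : occ t = fun w => lebesgue_measure
    (negative_until (X ^~ w) t)); last first.
  by apply/funext => w; exact: (occupation_below0E (G_starts w)).
apply: (@measurable_negative_length _ (g_sigma_algebraType F) _ X).
  by move=> u u0; exact: (sigma_gen_measurable_fun _ sub).
exact: X_right.
Qed.

Section cumulative.
Hypothesis e_law : has_exponential_law q e_q.
Hypothesis e_indep :
  indep_systems P (sigma_gen [set: unit] (fun=> e_q)) (process_sigma X).

(** Freezing the path fixes [occ t], and [e_q < occ t] is left. *)
Lemma cumulative_ruin_prob t : 0 < t ->
  let A := [set w | (cumulative_parisian_ruin (X ^~ w) (e_q w) < t%:E)%E] in
  measurable A /\
  P A = (\int[P]_w
    (1 - (expR (- q * fine (occupation_below0 (X ^~ w) t)))%:E))%E.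
Proof.
move=> t0 A.
pose F := \bigcup_(u in [set u : R | 0 <= u])
  preimage_set_system setT (X u : T -> R) measurable.
have FT : F `<=` measurable.
  apply: (@subset_trans _ (process_sigma X)); first exact: sub_sigma_algebra.
  exact: sigma_gen_measurable.
pose U : {RV P >-> g_sigma_algebraType F} :=
  HB.pack (id : T -> g_sigma_algebraType F)
    (isMeasurableFun.Build _ _ _ _ _ (measurable_coarsen FT)).
pose C := [set p : g_sigma_algebraType F * R | (p.2%:E < occ t p.1)%E].
have mC : measurable C.
  have m1 : measurable_fun [set: g_sigma_algebraType F * R] (fun p => p.2%:E).
    by apply/measurable_EFinP; exact: measurable_snd.
  have m2 : measurable_fun [set: g_sigma_algebraType F * R]
      (fun p => occ t p.1).
    have mocc := measurable_occ t (@subset_refl _ (process_sigma X)).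
    exact: (measurableT_comp mocc measurable_fst).
  by rewrite -[C]setTI; exact: measurable_lte.
have AC : A = [set w | C (U w, e_q w)].
  by apply/seteqP; split => w /(cumulative_ruin_ltP (G_starts w) _ t0).
split.
  have mU : measurable_fun [set: T] (fun w => (U w, e_q w)).
    exact: measurable_fun_pair.
  by rewrite AC -[X in measurable X]setTI; exact: mU.
rewrite AC freezing//; last first.
  move=> B D mB mD; rewrite setIC muleC; apply: e_indep => //.
  apply: sub_sigma_algebra; exists tt => //; exists D => //; exact: setTI.
apply: eq_integral => w _.
have -> : e_q @^-1` xsection C (U w) = [set w' | e_q w' < fine (occ t w)].
  apply/seteqP; split => w' /=; rewrite /xsection/= inE /C/=.
    by rewrite -(fineK (occ_fin w (ltW t0))).
  by rewrite -{2}(fineK (occ_fin w (ltW t0))).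
rewrite (exponential_law_lt e_law)// fine_ge0// /occ.
by rewrite (occupation_below0E (G_starts w)) measure_ge0.
Qed.

End cumulative.

Section exponential_marks.
Hypothesis E_law : forall k, has_exponential_law q (E k).
Hypothesis E_mutual : mutually_indep P E.
Hypothesis E_indep : indep_systems P (sigma_gen setT E)
  <<s process_sigma X `|` sigma_gen setT G >>.
Hypothesis mark_clock : forall w k g, G k w = g%:E -> mark g w = E k w.
Hypothesis mark_ge0 :
  forall w g, ~ excursion_starts (X ^~ w) g -> 0 <= mark g w.

(** Freezing the path and the list of its excursions fixes all the lengths at
    once, whose sum is the occupation time. *)
Lemma exponential_ruin_prob t : 0 < t ->
  let A :=
    [set w | (exponential_parisian_ruin (X ^~ w) (mark ^~ w) < t%:E)%E] in
  measurable A /\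
  P A = (\int[P]_w
    (1 - (expR (- q * fine (occupation_below0 (X ^~ w) t)))%:E))%E.
Proof.
move=> t0 A.
pose F := process_sigma X `|` sigma_gen setT G.
pose H := \bigcup_(k in [set: nat])
  preimage_set_system setT (E k : T -> R) measurable.
have FT : F `<=` measurable.
  by move=> B [|]; apply: sigma_gen_measurable => *.
have HT : H `<=` measurable.
  apply: (@subset_trans _ (sigma_gen setT E)); first exact: sub_sigma_algebra.
  exact: sigma_gen_measurable.
pose U : {RV P >-> g_sigma_algebraType F} :=
  HB.pack (id : T -> g_sigma_algebraType F)
    (isMeasurableFun.Build _ _ _ _ _ (measurable_coarsen FT)).
pose V : {RV P >-> g_sigma_algebraType H} :=
  HB.pack (id : T -> g_sigma_algebraType H)
    (isMeasurableFun.Build _ _ _ _ _ (measurable_coarsen HT)).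
pose len k w := lebesgue_measure (excursion (X ^~ w) (G k w) t).
have subX : process_sigma X `<=` <<s F >>.
  by apply: subset_trans (@sub_sigma_algebra _ _ _); exact: subsetUl.
have subG : sigma_gen setT G `<=` <<s F >>.
  by apply: subset_trans (@sub_sigma_algebra _ _ _); exact: subsetUr.
have mlen k : measurable_fun [set: g_sigma_algebraType F] (len k).
  apply: (@measurable_excursion_length _ (g_sigma_algebraType F) _ X _ _ G)
    => //.
    by move=> u u0; exact: (sigma_gen_measurable_fun _ subX).
  by move=> j; exact: (sigma_gen_measurable_fun _ subG).
have mE k : measurable_fun [set: g_sigma_algebraType H] (E k).
  exact: (@sigma_gen_measurable_fun _ _ _ _ _ setT E).
pose C := \bigcup_k [set p : g_sigma_algebraType F * g_sigma_algebraType H |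
  ((Num.max (E k p.2) 0)%:E < len k p.1)%E].
have mC : measurable C.
  apply: bigcupT_measurable => k.
  have m1 : measurable_fun [set: g_sigma_algebraType F * g_sigma_algebraType H]
      (fun p => (Num.max (E k p.2) 0)%:E).
    apply/measurable_EFinP; apply: measurable_maxr => //.
    exact: (measurableT_comp (mE k) measurable_snd).
  have m2 : measurable_fun [set: g_sigma_algebraType F * g_sigma_algebraType H]
      (fun p => len k p.1).
    exact: (measurableT_comp (mlen k) measurable_fst).
  by rewrite -[X in measurable X]setTI; exact: measurable_lte.
have AC : A = [set w | C (U w, V w)].
  apply/seteqP; split => w /=.
    move=> /(exponential_ruin_ltP (G_starts w) (@X_right w) (mark_clock (w:=w))
      (mark_ge0 (w:=w)))[k Ek].
    by exists k.
  move=> [k _ Ek].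
  apply/(exponential_ruin_ltP (G_starts w) (@X_right w) (mark_clock (w:=w))
      (mark_ge0 (w:=w))).
  by exists k.
split.
  have mUV : measurable_fun [set: T] (fun w => (U w, V w)).
    exact: measurable_fun_pair.
  by rewrite AC -[X in measurable X]setTI; exact: mUV.
rewrite AC freezing//; last first.
  move=> B D mB mD; rewrite setIC muleC; exact: E_indep.
apply: eq_integral => w _.
have len_sum : (\sum_(k <oo) len k w = occ t w)%E.
  by rewrite /occ -(occupation_below0_excursions (G_starts w) (@G_inj w)).
have len_fin k : len k w \is a fin_num.
  rewrite ge0_fin_numE//; apply: le_lt_trans (ltry t).
  apply: le_trans (negative_until_ub (G_starts w) (ltW t0)).
  apply: le_measure; rewrite ?inE; first exact: measurable_excursion.
    exact: measurable_negative_until (G_starts w) t.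
  by move=> s [st [fs _]].
rewrite -(prob_some_clock_lt E_law E_mutual (a := fun k => fine (len k w)))//.
- congr (P _); apply/seteqP; split => w' /=; rewrite /xsection/= inE /C/=.
    by move=> [k _ /= Ek]; exists k; rewrite -lte_fin fineK.
  by move=> [k Ek]; exists k; rewrite //= -(fineK (len_fin k)) lte_fin.
- by move=> k; rewrite fine_ge0// measure_ge0.
- rewrite -/(occ t w) fineK ?occ_fin ?ltW// -len_sum.
  by apply: eq_eseriesr => k _; rewrite fineK.
Qed.

End exponential_marks.
End ruin_probabilities.

Theorem proposition2p4 (d : measure_display) (T : measurableType d)
    (R : realType) (P : probability T R) (x q : R)
    (X : R -> {RV P >-> R}) (e_q : {RV P >-> R}) (mark : R -> T -> R) :
  0 <= x -> 0 < q ->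
  levy_insurance_risk_process x X ->
  has_exponential_law q e_q ->
  indep_systems P (sigma_gen [set: unit] (fun=> e_q)) (process_sigma X) ->
  exponential_excursion_marks P X q mark ->
  let kappa w := exponential_parisian_ruin (X ^~ w) (mark ^~ w) in
  let sigma w := cumulative_parisian_ruin (X ^~ w) (e_q w) in
  (forall t : R, 0 < t ->
    P [set w | (kappa w <= t%:E)%E] = P [set w | (sigma w <= t%:E)%E]) /\
  P [set w | (kappa w < +oo)%E] = P [set w | (sigma w < +oo)%E].
Proof.
move=> _ _ levyX e_law e_indep [G [E [G_starts G_inj
  [E_law E_mutual E_indep mark_clock mark_ge0]]]] kappa sigma.
have X_right w t : 0 <= t -> X s w @[s --> t^'+] --> X t w.
  by have [h _] := levy_cadlag levyX w; exact: h.
have kappaP t (t0 : 0 < t) := exponential_ruin_prob X_right G_starts G_inj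
  E_law E_mutual E_indep mark_clock mark_ge0 t0.
have sigmaP t (t0 : 0 < t) := cumulative_ruin_prob X_right G_starts
  e_law e_indep t0.
have mkappa s : 0 < s -> measurable [set w | (kappa w < s%:E)%E].
  by move=> s0; exact: (kappaP s s0).1.
have msigma s : 0 < s -> measurable [set w | (sigma w < s%:E)%E].
  by move=> s0; exact: (sigmaP s s0).1.
have eq_lt s : 0 < s ->
    P [set w | (kappa w < s%:E)%E] = P [set w | (sigma w < s%:E)%E].
  by move=> s0; rewrite (kappaP s s0).2 (sigmaP s s0).2.
split=> [t t0|].
  have mk s : t < s -> measurable [set w | (kappa w < s%:E)%E].
    by move=> ts; exact: mkappa (lt_trans t0 ts).
  have ms s : t < s -> measurable [set w | (sigma w < s%:E)%E].
    by move=> ts; exact: msigma (lt_trans t0 ts).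
  rewrite -(cvg_lim _ (cvg_prob_right (P := P) mk))//.
  rewrite -(cvg_lim _ (cvg_prob_right (P := P) ms))//.
  by congr (limn _); apply/funext => n; apply: eq_lt; rewrite addr_gt0.
rewrite -(cvg_lim _ (cvg_prob_lty (P := P) mkappa))//.
rewrite -(cvg_lim _ (cvg_prob_lty (P := P) msigma))//.
by congr (limn _); apply/funext => n; apply: eq_lt.
Qed.
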